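(* Let $n\ge 2$. For every Schur-positive set $A\subseteq\mathfrak{S}_{n-1}$, the set $AC_n=\{\sigma c:\ \sigma\in A,\ c\in C_n\}\subseteq\mathfrak{S}_n$ is cyclic Schur-positive.
   Context: Permutations are written in one-line notation and composed right to left, $(\sigma\tau)(i)=\sigma(\tau(i))$. For $\pi\in\mathfrak{S}_n$, $\mathrm{Des}(\pi)=\{i\in[n-1]:\pi(i)>\pi(i+1)\}$ and the cyclic descent set is $\mathrm{cDes}(\pi)=\{i\in[n]:\pi(i)>\pi(i+1)\}$ with the convention $\pi(n+1):=\pi(1)$. For $J\subseteq[n]$ write $\mathbf{x}^J=\prod_{i\in J}x_i$, and for an integer $i$ let $i+J=\{i+j \bmod n: j\in J\}\subseteq[n]$ (residues in $[n]$). Let $c_n=(1,2,\dots,n)=23\cdots n1$ and $C_n=\langle c_n\rangle$; $\mathfrak{S}_{n-1}$ is identified with the permutations in $\mathfrak{S}_n$ fixing $n$. Schur-positivity: for $D\subseteq[n-1]$ let $\mathcal{F}_{n,D}=\sum x_{i_1}\cdots x_{i_n}$, summed over $i_1\le\cdots\le i_n$ with $i_j<i_{j+1}$ whenever $j\in D$ (Gessel's fundamental quasisymmetric function). A set $A\subseteq\mathfrak{S}_m$ is Schur-positive if $\sum_{\pi\in A}\mathcal{F}_{m,\mathrm{Des}(\pi)}$ is symmetric and has nonnegative coefficients in the Schur basis. Cyclic Schur-positivity: for a skew shape $\lambda/\mu$ with $n$ cells (English notation), the descent set of a standard Young tableau $T$ is the set of $i\in[n-1]$ such that $i+1$ lies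 in a strictly lower row than $i$. A cyclic descent extension on $\mathrm{SYT}(\lambda/\mu)$ is a pair $(\mathrm{cDes},\psi)$, where $\mathrm{cDes}:\mathrm{SYT}(\lambda/\mu)\to 2^{[n]}$ and $\psi$ is a bijection of $\mathrm{SYT}(\lambda/\mu)$, such that for all $T$: $\mathrm{cDes}(T)\cap[n-1]=\mathrm{Des}(T)$, $\mathrm{cDes}(\psi T)=1+\mathrm{cDes}(T)$, and $\emptyset\ne\mathrm{cDes}(T)\ne[n]$. Such an extension exists if and only if $\lambda/\mu$ is not a connected ribbon, and then $\sum_{T\in\mathrm{SYT}(\lambda/\mu)}\mathbf{x}^{\mathrm{cDes}(T)}$ does not depend on the choice of extension. A set $A\subseteq\mathfrak{S}_n$ is cyclic Schur-positive (cSp) if there are nonnegative integers $m_{\lambda/\mu}$, indexed by skew shapes with $n$ cells that are not connected ribbons, such that $\sum_{\pi\in A}\mathbf{x}^{\mathrm{cDes}(\pi)}=\sum_{\lambda/\mu}m_{\lambda/\mu}\sum_{T\in\mathrm{SYT}(\lambda/\mu)}\mathbf{x}^{\mathrm{cDes}(T)}$. *)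

(* Defs.v *)
From HB Require Import structures.
From mathcomp Require Import all_boot all_order all_algebra all_fingroup.
From mathcomp Require Import mpoly.

Set Implicit Arguments.
Unset Strict Implicit.
Unset Printing Implicit Defensive.

Import GRing.Theory.
Local Open Scope ring_scope.

(* Conventions.  A position/value i in [n] = {1,...,n} is encoded by the
   ordinal i-1 : 'I_n.  A subset J of [n] is encoded as a {set 'I_n}.
   Permutations are elements of 'S_n = {perm 'I_n}; one-line notation
   pi(i) is (pi (i-1)) + 1.  Note: mathcomp's product satisfies
   (s * t) x = t (s x), so the paper's composition sigma tau is t * s. *)

Definition Des (n : nat) (pi : 'S_n) : {set 'I_n} :=
  [set k : 'I_n | (k.+1 < n)%N && (pi (ordS k) < pi k)%N].

Definition cDes (n : nat) (pi : 'S_n) : {set 'I_n} :=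
  [set k : 'I_n | (pi (ordS k) < pi k)%N].

Definition cyc (n : nat) : 'S_n := perm (@ordS_inj n).

Definition Cn (n : nat) : {set 'S_n} := [set (cyc n ^+ k)%g | k : 'I_n].

(* S_{n-1} identified with the permutations of [n] fixing n (n = m.+1) *)
Definition embed (m : nat) (s : 'S_m) : 'S_m.+1 := lift_perm ord_max ord_max s.

(* A C_n = { sigma c : sigma in A, c in C_n }; sigma c = sigma o c is
   written (c * sigma) in mathcomp. *)
Definition ACn (m : nat) (A : {set 'S_m}) : {set 'S_m.+1} :=
  [set (c * embed s)%g | c in Cn m.+1, s in A].

Definition xmon (n : nat) (J : {set 'I_n}) : {mpoly int[n]} :=
  \prod_(k in J) 'X_k.

Definition is_part (la : seq nat) : bool :=
  sorted geq la && all (fun x => 0 < x)%N la.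

(* cell (r, c) (0-indexed row r, column c, English notation) of la/mu *)
Definition inskew (la mu : seq nat) (r c : nat) : bool :=
  (nth 0 mu r <= c)%N && (c < nth 0 la r)%N.

Definition skew_shape (la mu : seq nat) (n : nat) : bool :=
  [&& is_part la, is_part mu, (size mu <= size la)%N,
      [forall i : 'I_(size mu), nth 0 mu i <= nth 0 la i]%N
    & (sumn la - sumn mu == n)%N].

(* the finite type of cells of la/mu (all of them lie in the box
   size la x la_1 when la is a partition) *)
Definition cellT (la mu : seq nat) :=
  {x : 'I_(size la) * 'I_(nth 0 la 0) | inskew la mu x.1 x.2}.

Definition row (la mu : seq nat) (x : cellT la mu) : nat := (val x).1.
Definition col (la mu : seq nat) (x : cellT la mu) : nat := (val x).2.

Definition adj (la mu : seq nat) : rel (cellT la mu) :=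
  fun x y =>
    ((row x == row y) && (((col x).+1 == col y) || ((col y).+1 == col x)))
    || ((col x == col y) && (((row x).+1 == row y) || ((row y).+1 == row x))).

Definition connected_ribbon (la mu : seq nat) : bool :=
  [forall x : cellT la mu, forall y : cellT la mu, connect (@adj la mu) x y]
  && ~~ [exists x : cellT la mu,
           [&& inskew la mu (row x).+1 (col x), inskew la mu (row x) (col x).+1
             & inskew la mu (row x).+1 (col x).+1]].

(* A filling T : cells -> 'I_n, where T x = k means cell x contains k+1. *)
Definition tab (la mu : seq nat) (n : nat) := {ffun cellT la mu -> 'I_n}.

Definition SYT (la mu : seq nat) (n : nat) : {set tab la mu n} :=
  [set T : tab la mu n |
     [&& injectiveb T, [forall k : 'I_n, exists x, T x == k]
       & [forall x, forall y,
            ((row x == row y) && (col x < col y)%N ==> (T x < T y)%N)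
            && ((col x == col y) && (row x < row y)%N ==> (T x < T y)%N)]]].

Definition DesT (la mu : seq nat) (n : nat) (T : tab la mu n) : {set 'I_n} :=
  [set k : 'I_n | (k.+1 < n)%N &&
     [exists x, exists y,
        [&& (val (T x) == k), (val (T y) == k.+1) & (row x < row y)%N]]].

Definition cyc_desc_ext (la mu : seq nat) (n : nat)
    (cD : tab la mu n -> {set 'I_n}) (psi : tab la mu n -> tab la mu n) : Prop :=
  [/\ {in SYT la mu n, forall T, psi T \in SYT la mu n},
      {in SYT la mu n &, injective psi},
      {in SYT la mu n, forall T,
          cD T :&: [set k : 'I_n | (k.+1 < n)%N] = DesT T},
      {in SYT la mu n, forall T, cD (psi T) = [set ordS k | k in cD T]}
    & {in SYT la mu n, forall T, cD T != set0 /\ cD T != setT}].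

(* g = sum_{T in SYT(la/mu)} x^{cDes(T)} for some cyclic descent extension
   (the sum does not depend on the choice of the extension) *)
Definition cdes_gf (la mu : seq nat) (n : nat) (g : {mpoly int[n]}) : Prop :=
  exists (cD : tab la mu n -> {set 'I_n}) (psi : tab la mu n -> tab la mu n),
    cyc_desc_ext cD psi /\ g = \sum_(T in SYT la mu n) xmon (cD T).

(* cyclic Schur-positivity: the multiplicities m_{la/mu} are encoded by a
   finite list of shapes with repetitions; each entry carries the
   generating function of its shape. *)
Definition cSp (n : nat) (A : {set 'S_n}) : Prop :=
  exists L : seq ((seq nat * seq nat) * {mpoly int[n]}),
    (forall t, t \in L ->
       [/\ skew_shape t.1.1 t.1.2 n, ~~ connected_ribbon t.1.1 t.1.2
         & cdes_gf t.1.1 t.1.2 t.2])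
    /\ \sum_(pi in A) xmon (cDes pi) = \sum_(t <- L) t.2.

Definition fundQ (N m : nat) (D : {set 'I_m}) : {mpoly int[N]} :=
  \sum_(f : {ffun 'I_m -> 'I_N} |
          [forall j : 'I_m, forall j' : 'I_m,
             (j.+1 == j' :> nat) ==> ((f j <= f j')%N && ((j \in D) ==> (f j < f j')%N))])
     \prod_(j < m) 'X_(f j).

Definition schur (N : nat) (la : seq nat) : {mpoly int[N]} :=
  \sum_(f : {ffun cellT la [::] -> 'I_N} |
          [forall x, forall y,
             ((row x == row y) && (col x < col y)%N ==> (f x <= f y)%N)
             && ((col x == col y) && (row x < row y)%N ==> (f x < f y)%N)])
     \prod_(x : cellT la [::]) 'X_(f x).

(* A subset of S_m is Schur-positive: sum_{pi in A} F_{m,Des pi} equals a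
   nonnegative integer combination of Schur functions (coefficients encoded
   as a list of partitions of m with repetition).  Identity of symmetric
   functions of degree m in infinitely many variables is expressed as the
   identity of all its truncations to N variables. *)
Definition SchurPos (m : nat) (A : {set 'S_m}) : Prop :=
  exists ps : seq (seq nat),
    (forall la, la \in ps -> is_part la && (sumn la == m)) /\
    forall N : nat, \sum_(pi in A) fundQ N (Des pi) = \sum_(la <- ps) schur N la.

(* Main.v *)
(** Since [cDes (sigma c^k)] is [Des sigma] together with [n], rotated by [- k],
the cyclic descent sum of [A C_n] only depends on the descent distribution of
[A]; by linear independence of the fundamental quasisymmetric functions, that is
the distribution of [Des] over the union of the [SYT(la)], for a list of
partitions [la] of [n - 1].

For one [la], attach to it a disconnected box to the north-east.  The tableaux of
this shape are in bijection with pairs [(T, k)], [T] in [SYT(la)]: the box gets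
the entry [k], and the other entries, once relabelled, are the tableau obtained
from [T] by switching its first [n - k] entries past its last [k - 1] ones.
Tableau switching preserves the descents inside both blocks, so the descent set
of the result is, up to the element [n], the rotation by [k] of the union of
[Des T] and [n]; this rotation serves as the cyclic descent set.  Switching
is a product of Bender-Knuth toggles, and its effect on descents reduces to a
computation with three consecutive entries. *)

From Pilot Require Import Defs.
From HB Require Import structures.
From mathcomp Require Import all_boot all_order all_algebra all_fingroup.
From mathcomp Require Import mpoly.
From mathcomp Require Import zify.
Import Pilot.Defs.

Set Implicit Arguments.
Unset Strict Implicit.
Unset Printing Implicit Defensive.

Import GRing.Theory Num.Theory.

(** * Standard fillings of a skew shape and their consecutive entries *)

Definition mk_cell (la mu : seq nat) (r : 'I_(size la)) (c : 'I_(nth 0%R la 0%R))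
    (h : inskew la mu r c) : cellT la mu :=
  exist (fun x : 'I_(size la) * 'I_(nth 0%R la 0%R) => inskew la mu x.1 x.2) (r, c) h.

Section SkewTableaux.

Variables (la mu : seq nat) (n : nat).
Local Notation cell := (cellT la mu).
Implicit Types (x y z : cell) (T : tab la mu n) (R : rel cell).

Lemma cell_inj x y : row x = row y -> col x = col y -> x = y.
Proof.
move=> hr hc; apply: val_inj; case: x y hr hc => [[a b] ?] [[c d] ?] /=.
by rewrite /row /col /= => /val_inj -> /val_inj ->.
Qed.

Lemma SYT_inj T : T \in SYT la mu n -> injective T.
Proof. by rewrite inE => /and3P[/injectiveP]. Qed.

Lemma SYT_surj T (v : nat) : T \in SYT la mu n -> v < n ->
  exists x, T x = v :> nat.
Proof.
rewrite inE => /and3P[_ /forallP h _] hv.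
by have /existsP[x /eqP hx] := h (Ordinal hv); exists x; rewrite hx.
Qed.

Lemma SYT_row T x y : T \in SYT la mu n ->
  row x = row y -> col x < col y -> T x < T y.
Proof.
rewrite inE => /and3P[_ _ /forallP h] hr hc.
by have /forallP/(_ y)/andP[/implyP] := h x; rewrite hr hc eqxx => ->.
Qed.

Lemma SYT_col T x y : T \in SYT la mu n ->
  col x = col y -> row x < row y -> T x < T y.
Proof.
rewrite inE => /and3P[_ _ /forallP h] hr hc.
by have /forallP/(_ y)/andP[_ /implyP] := h x; rewrite hr hc eqxx => ->.
Qed.

(** Descents and the alignment test of the toggles are both instances. Quantifying over the two
    cells makes the value false when [v.+1] is not an entry. *)
Definition at_consec (R : rel cell) T (v : nat) :=
  [exists x, exists y, [&& T x == v :> nat, T y == v.+1 :> nat & R x y]].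

Lemma at_consecP R T v :
  reflect (exists x y, [/\ T x = v :> nat, T y = v.+1 :> nat & R x y]) (at_consec R T v).
Proof.
apply: (iffP existsP) => [[x /existsP[y /and3P[/eqP ? /eqP ? ?]]]|[x [y [h1 h2 h3]]]].
  by exists x, y.
by exists x; apply/existsP; exists y; rewrite /= h1 h2 !eqxx.
Qed.

Definition descends T v := at_consec (fun x y => row x < row y) T v.

Lemma mem_DesT T (k : 'I_n) : (k \in DesT T) = descends T k.
Proof.
rewrite inE; apply: andb_idl => h; have /at_consecP[x [y [_ <- _]]] : descends T k := h.
exact: ltn_ord.
Qed.

Lemma DesT_sub T : DesT T \subset [set d : 'I_n | d.+1 < n].
Proof. by apply/subsetP=> d; rewrite !inE => /andP[]. Qed.

Lemma at_consecE R T x y v : injective T -> T x = v :> nat -> T y = v.+1 :> nat ->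
  at_consec R T v = R x y.
Proof.
move=> injT hx hy; apply/idP/idP => [|h].
  case/at_consecP=> x' [y' [h1 h2]].
  have -> : x' = x by apply: injT; apply: val_inj; rewrite /= h1 hx.
  by have -> : y' = y by apply: injT; apply: val_inj; rewrite /= h2 hy.
by apply/at_consecP; exists x, y.
Qed.

Lemma at_consec_ge R T v : n <= v.+1 -> at_consec R T v = false.
Proof.
move=> hv; apply/at_consecP=> -[x [y [_ h _]]].
by have := ltn_ord (T y); rewrite h ltnNge hv.
Qed.

End SkewTableaux.

(** * Bender-Knuth toggles on standard tableaux *)

Section Toggles.

Variables (la mu : seq nat) (m0 : nat).
Local Notation m := m0.+1.
Local Notation cell := (cellT la mu).
Local Notation tableau := (tab la mu m).
Implicit Types (x y z : cell) (T : tableau) (R : rel cell).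

Definition aligned x y := (row x == row y) || (col x == col y).

Definition swap_entries (i : nat) T : tableau :=
  [ffun x => tperm (inord i) (inord i.+1) (T x)].

(** The Bender-Knuth involution on standard tableaux: when [i] and [i.+1] share a row or a column,
    exchanging them would break standardness. *)
Definition toggle (i : nat) T : tableau :=
  if at_consec aligned T i then T else swap_entries i T.

Lemma swap_entriesE i T x : i.+1 < m ->
  swap_entries i T x = (if T x == i :> nat then i.+1
                        else if T x == i.+1 :> nat then i else T x) :> nat.
Proof.
move=> hi; have hi' := ltnW hi; rewrite ffunE; case: tpermP => [->|->|h1 h2].
- by rewrite !inordK // eqxx.
- by rewrite !inordK // eqxx gtn_eqF.
- rewrite !ifN //.
  + by apply: contra_notN h2 => /eqP h; apply: val_inj; rewrite /= inordK.
  + by apply: contra_notN h1 => /eqP h; apply: val_inj; rewrite /= inordK.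
Qed.

Lemma swap_entriesK i : involutive (swap_entries i).
Proof. by move=> T; apply/ffunP=> x; rewrite !ffunE tpermK. Qed.

Lemma at_consec_swap R i T v : i.+1 < m -> (i.+1 < v) || (v.+1 < i) ->
  at_consec R (swap_entries i T) v = at_consec R T v.
Proof.
move=> hi h; apply: eq_existsb => x; apply: eq_existsb => y.
rewrite !swap_entriesE //; case/orP: h => h; congr [&& _, _ & _]; do ?[case: ifP => ?]; lia.
Qed.

Lemma at_consec_toggle R i T v : i.+1 < m -> (i.+1 < v) || (v.+1 < i) ->
  at_consec R (toggle i T) v = at_consec R T v.
Proof. by move=> hi h; rewrite /toggle; case: ifP => // _; apply: at_consec_swap. Qed.

Lemma aligned_sym x y : aligned x y = aligned y x.
Proof. by rewrite /aligned eq_sym [col x == _]eq_sym. Qed.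

Lemma aligned_swap i T : i.+1 < m ->
  at_consec aligned (swap_entries i T) i = at_consec aligned T i.
Proof.
move=> hi; suff imp T' : at_consec aligned T' i -> at_consec aligned (swap_entries i T') i.
  apply/idP/idP; last exact: imp.
  by move/imp; rewrite swap_entriesK.
case/at_consecP=> x [y [hx hy hxy]]; apply/at_consecP; exists y, x.
by rewrite !swap_entriesE // hx hy !eqxx gtn_eqF // aligned_sym.
Qed.

Lemma toggleK i : i.+1 < m -> involutive (toggle i).
Proof.
move=> hi T; rewrite {2}/toggle; case: ifP => h; first by rewrite /toggle h.
by rewrite /toggle aligned_swap // h swap_entriesK.
Qed.

(** The pairs [i, i.+1] and [j, j.+1] are disjoint, so neither exchange affects the alignment test
    of the other. *)
Lemma toggleC i j T : i.+1 < j -> j.+1 < m ->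
  toggle i (toggle j T) = toggle j (toggle i T).
Proof.
move=> hij hj; have hi : i.+1 < m by lia.
have sC : swap_entries i (swap_entries j T) = swap_entries j (swap_entries i T).
  apply/ffunP=> x; apply: val_inj; rewrite /= !swap_entriesE //.
  move: (nat_of_ord (T x)) => v.
  case h1: (v == i); case h2: (v == i.+1); case h3: (v == j); case h4: (v == j.+1);
  rewrite ?h1 ?h2 ?h3 ?h4 /=; do ?[case: ifP => ?]; lia.
rewrite /toggle; case hi' : (at_consec aligned T i); case hj' : (at_consec aligned T j);
  rewrite ?hi' ?hj' // ?at_consec_swap ?hi' ?hj' ?hij ?orbT //.
Qed.

(** An exchange alters only the relative order of [i] and [i.+1], and it takes place only when their
    cells are not aligned. *)
Lemma toggle_SYT i T : i.+1 < m -> T \in SYT la mu m -> toggle i T \in SYT la mu m.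
Proof.
move=> hi hT; rewrite /toggle; case: ifP => // hn.
have nal x y : T x = i :> nat -> T y = i.+1 :> nat -> ~~ aligned x y.
  by move=> hx hy; rewrite -(at_consecE _ (SYT_inj hT) hx hy) hn.
rewrite inE; apply/and3P; split.
- apply/injectiveP=> x y; rewrite !ffunE => /perm_inj; exact: SYT_inj.
- apply/forallP=> k; have [x hx] := SYT_surj hT (ltn_ord (tperm (inord i) (inord i.+1) k)).
  apply/existsP; exists x; rewrite ffunE; apply/eqP.
  by rewrite -[RHS](tpermK (inord i) (inord i.+1)); congr (tperm _ _ _); apply: val_inj.
apply/forallP=> x; apply/forallP=> y; rewrite !swap_entriesE //.
have h : aligned x y -> T x < T y -> (if T x == i :> nat then i.+1
                        else if T x == i.+1 :> nat then i else T x) <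
   (if T y == i :> nat then i.+1 else if T y == i.+1 :> nat then i else T y).
  move=> hal hlt; have := nal x y; rewrite hal; do ?[case: ifP => ?]; lia.
apply/andP; split; apply/implyP=> /andP[/eqP h1 h2]; apply: h.
- by rewrite /aligned h1 eqxx.
- exact: SYT_row.
- by rewrite /aligned h1 eqxx orbT.
- exact: SYT_col.
Qed.

Lemma toggle_aligned i T x y : T \in SYT la mu m -> T x = i :> nat -> T y = i.+1 :> nat ->
  aligned x y -> toggle i T = T.
Proof. by move=> hT hx hy h; rewrite /toggle (at_consecE _ (SYT_inj hT) hx hy) h. Qed.

Lemma toggle_free i T x y : T \in SYT la mu m -> T x = i :> nat -> T y = i.+1 :> nat ->
  ~~ aligned x y -> toggle i T = swap_entries i T.
Proof. by move=> hT hx hy h; rewrite /toggle (at_consecE _ (SYT_inj hT) hx hy) (negPf h). Qed.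

End Toggles.

(** * Tableau switching in straight shapes and its effect on descents *)

Section StraightTableaux.

Variables (la : seq nat) (m0 : nat).
Hypothesis la_part : is_part la.
Local Notation m := m0.+1.
Local Notation cell := (cellT la [::]).
Local Notation tableau := (tab la [::] m).
Implicit Types (x y z : cell) (T : tableau).

Lemma inskew_cell x : inskew la [::] (row x) (col x).
Proof. exact: (valP x). Qed.

Lemma part_nonincreasing i j : i <= j -> nth 0 la j <= nth 0 la i.
Proof.
case/andP: la_part => hs _ hij.
case: (ltnP j (size la)) => hj; last by rewrite [nth 0 la j]nth_default.
have ht : transitive geq by move=> p q r; rewrite /= => h1 h2; apply: leq_trans h2 h1.
exact: (sorted_leq_nth ht leqnn 0 hs i j (leq_ltn_trans hij hj) hj hij).
Qed.

Lemma cell_ex r c : c < nth 0 la r -> exists2 x : cell, row x = r & col x = c.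
Proof.
move=> h; have hr : r < size la.
  by rewrite ltnNge; apply/negP=> hs; rewrite nth_default in h.
have hc : c < nth 0 la 0 by apply: leq_trans h (part_nonincreasing (leq0n r)).
have hi : inskew la [::] (Ordinal hr) (Ordinal hc) by rewrite /inskew nth_nil.
by exists (mk_cell hi).
Qed.

Lemma cell_below x r c : r <= row x -> c <= col x ->
  exists2 z : cell, row z = r & col z = c.
Proof.
move=> hr hc; apply: cell_ex; have := inskew_cell x.
rewrite /inskew nth_nil /= => h.
exact: leq_ltn_trans hc (leq_trans h (part_nonincreasing hr)).
Qed.

(** Go along the row of [x] to the column of [y], then down to [y]; the corner is a cell because a
    straight shape contains everything north-west of [y]. *)
Lemma SYT_mono T x y : T \in SYT la [::] m ->
  row x <= row y -> col x <= col y -> T x <= T y.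
Proof.
move=> hT hr hc; have [z zr zc] := cell_below hr (leqnn (col y)).
apply: (@leq_trans (T z)).
  case: (ltngtP (col x) (col y)) => [hlt||he]; last 2 first.
  - by rewrite ltnNge hc.
  - by rewrite (@cell_inj _ _ x z) ?zr ?zc.
  by apply/ltnW/SYT_row; rewrite ?zr ?zc.
case: (ltngtP (row x) (row y)) => [hlt||he]; last 2 first.
- by rewrite ltnNge hr.
- by rewrite (@cell_inj _ _ z y) ?zr ?zc.
by apply/ltnW/SYT_col; rewrite ?zr ?zc.
Qed.

(* A case analysis on the cells [a], [b], [c] of three consecutive entries: two
   aligned ones span a rectangle of cells of the shape, all of whose entries lie
   between theirs. *)
Lemma descends_toggle2 i T : T \in SYT la [::] m -> i.+2 < m ->
  descends (toggle i (toggle i.+1 T)) i.+1 = descends T i.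
Proof.
move=> hT hi.
have [|a ha] := @SYT_surj _ _ _ T i hT; first lia.
have [|b hb] := @SYT_surj _ _ _ T i.+1 hT; first lia.
have [c hc] := SYT_surj hT hi.
have hT1 : toggle i.+1 T \in SYT la [::] m by apply: toggle_SYT.
have hT2 : toggle i (toggle i.+1 T) \in SYT la [::] m by apply: toggle_SYT => //; lia.
rewrite /descends [RHS](at_consecE _ (SYT_inj hT) ha hb).
have mono_ab : ~~ ((row b <= row a) && (col b <= col a)).
  by apply/negP=> /andP[h1 h2]; have := SYT_mono hT h1 h2; lia.
have mono_bc : ~~ ((row c <= row b) && (col c <= col b)).
  by apply/negP=> /andP[h1 h2]; have := SYT_mono hT h1 h2; lia.
have mono_ac : ~~ ((row c <= row a) && (col c <= col a)).
  by apply/negP=> /andP[h1 h2]; have := SYT_mono hT h1 h2; lia.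
have rect u w r q : i <= T u -> T w <= i.+2 -> row u <= r <= row w -> col u <= q <= col w ->
    r = row a /\ q = col a \/ r = row b /\ q = col b \/ r = row c /\ q = col c.
  move=> hu hw /andP[r1 r2] /andP[q1 q2]; have [z zr zq] := cell_below r2 q2.
  rewrite -zr -zq; rewrite -zr in r1 r2; rewrite -zq in q1 q2.
  have h1 := SYT_mono hT r1 q1; have h2 := SYT_mono hT r2 q2.
  have uniq d : T z = T d :> nat -> z = d by move=> h; apply/(SYT_inj hT)/val_inj.
  have : T z = T a :> nat \/ (T z = T b :> nat \/ T z = T c :> nat) by lia.
  by case=> [/uniq ->|[/uniq ->|/uniq ->]]; tauto.
(* In the four cases below, the entries [i.+1] and [i.+2] end in [b, c], then [a, c], then [c, b],
   then [a, b]. The last pair gives the claim at once; the others need a corner from [rect]. *)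
case hbc : (aligned b c).
- have e1 : toggle i.+1 T = T by apply: toggle_aligned hbc.
  rewrite e1 in hT2 *.
  case hab : (aligned a b).
  + have e2 : toggle i T = T by apply: toggle_aligned hab.
    rewrite e2 (at_consecE _ (SYT_inj hT) hb hc).
    (* If one of the pairs [a, b] and [b, c] shared a row and the other a column, the fourth corner
       would be a further cell with an entry between [i] and [i.+2]. *)
    have r1 := rect a c (row c) (col a); have r2 := rect a c (row a) (col c).
    rewrite /aligned in hab hbc; lia.
  + have e2 : toggle i T = swap_entries i T by apply: toggle_free (negbT hab).
    rewrite e2 in hT2 *.
    rewrite (@at_consecE _ _ _ _ _ a c _ (SYT_inj hT2)); last 2 first.
    * rewrite swap_entriesE; [do ?[case: ifP => ?]; lia|lia].
    * rewrite swap_entriesE; [do ?[case: ifP => ?]; lia|lia].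
    have r1 := rect b c (row a) (col b).
    rewrite /aligned in hab hbc; lia.
- have e1 : toggle i.+1 T = swap_entries i.+1 T by apply: toggle_free (negbT hbc).
  rewrite e1 in hT1 hT2 *.
  have hc1 : swap_entries i.+1 T c = i.+1 :> nat by rewrite swap_entriesE; [do ?[case: ifP => ?]; lia|lia].
  have hb1 : swap_entries i.+1 T b = i.+2 :> nat by rewrite swap_entriesE; [do ?[case: ifP => ?]; lia|lia].
  have ha1 : swap_entries i.+1 T a = i :> nat by rewrite swap_entriesE; [do ?[case: ifP => ?]; lia|lia].
  case hac : (aligned a c).
  + have e2 : toggle i (swap_entries i.+1 T) = swap_entries i.+1 T by apply: toggle_aligned hac.
    rewrite e2 (at_consecE _ (SYT_inj hT1) hc1 hb1).
    have r1 := rect a c (row b) (col a).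
    rewrite /aligned in hac hbc; lia.
  + have e2 := toggle_free hT1 ha1 hc1 (negbT hac).
    rewrite e2 in hT2 *.
    rewrite (@at_consecE _ _ _ _ _ a b _ (SYT_inj hT2)) //.
    * rewrite swap_entriesE; [do ?[case: ifP => ?]; lia|lia].
    * rewrite swap_entriesE; [do ?[case: ifP => ?]; lia|lia].
Qed.

(** This is [descends_toggle2] applied to [toggle i.+1 (toggle i T)], since toggles are
    involutions. *)
Lemma descends_toggle2V i T : T \in SYT la [::] m -> i.+2 < m ->
  descends (toggle i.+1 (toggle i T)) i = descends T i.+1.
Proof.
move=> hT hi; have hi' := ltnW hi; rewrite -descends_toggle2 //.
  by rewrite !toggleK.
by apply: toggle_SYT => //; apply: toggle_SYT.
Qed.

(* [slide a o] moves entry [o + a] past the [a] entries just below it;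
   [switch a p] so moves entries [a, ..., a + p - 1] past [0, ..., a - 1]. *)
Fixpoint slide a o T : tableau := if a is b.+1 then slide b o (toggle (o + b) T) else T.

Fixpoint switch a p T : tableau := if p is q.+1 then slide a q (switch a q T) else T.

Lemma slide_SYT a o T : o + a < m -> T \in SYT la [::] m -> slide a o T \in SYT la [::] m.
Proof.
elim: a T => //= a IH T h hT; apply: IH; first lia.
by apply: toggle_SYT => //; lia.
Qed.

Lemma slide_inj a o : o + a < m -> injective (slide a o).
Proof.
elim: a => [|a IH] h T1 T2 //= /IH e; have h' : (o + a).+1 < m by lia.
by apply: (can_inj (toggleK h')); apply: e; lia.
Qed.

Lemma switch_SYT a p T : p + a <= m -> T \in SYT la [::] m -> switch a p T \in SYT la [::] m.
Proof.
elim: p => //= p IH h hT; apply: slide_SYT; first lia.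
by apply: IH => //; lia.
Qed.

Lemma switch_inj a p : p + a <= m -> injective (switch a p).
Proof.
elim: p => [|p IH] h T1 T2 //= e; apply: IH; first lia.
by apply: slide_inj e; lia.
Qed.

Lemma descends_slide_far a o T v : o + a < m -> (o + a < v) || (v.+1 < o) ->
  descends (slide a o T) v = descends T v.
Proof.
elim: a T => //= a IH T h hv; rewrite IH; try lia.
by apply: at_consec_toggle; lia.
Qed.

(** The slide raises the entries [o, ..., o + a - 1] by one. Only its consecutive toggles at [v.+1]
    and [v] matter for the pair [v, v.+1]; they carry its descent up by [descends_toggle2]. *)
Lemma descends_slide a o T v : T \in SYT la [::] m -> o + a < m ->
  o <= v -> v.+1 < o + a -> descends (slide a o T) v.+1 = descends T v.
Proof.
elim: a T => [|a IH] T hT h h1 h2 /=; first lia.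
have hT' : toggle (o + a) T \in SYT la [::] m by apply: toggle_SYT => //; lia.
case: (ltnP v.+1 (o + a)) => hv.
  rewrite IH //; try lia.
  by apply: at_consec_toggle; lia.
(* Here [v.+1 = o + a]: the first two toggles of the slide carry the descent up, and the remaining
   ones act on smaller entries. *)
case: a => [|a] in IH h h2 hT' hv * => /=; first lia.
have -> : v = o + a by lia.
rewrite descends_slide_far; try lia.
by rewrite addnS descends_toggle2 //; lia.
Qed.

Lemma slide_toggleC a o j T : o + a < j -> j.+1 < m ->
  toggle j (slide a o T) = slide a o (toggle j T).
Proof.
elim: a T => [|a IH] T h hj; first by [].
rewrite [LHS]/= [RHS]/= IH; [|lia|lia].
by congr slide; symmetry; apply: toggleC; lia.
Qed.

(** Two successive slides bring the entries [o + a] and [(o + a).+1] down together. The first toggle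
    of the second slide commutes with all but the first toggle of the first slide, so the toggles
    pair up and each pair lowers the descent by [descends_toggle2V]. *)
Lemma descends_slide2 a o T : T \in SYT la [::] m -> (o + a).+1 < m ->
  descends (slide a o.+1 (slide a o T)) o = descends T (o + a).
Proof.
elim: a T => [|a IH] T hT h /=; first by rewrite addn0.
rewrite slide_toggleC; try lia.
rewrite IH; try lia.
  by rewrite addSn addnS descends_toggle2V //; lia.
by apply: toggle_SYT; [lia|apply: toggle_SYT => //; lia].
Qed.

Lemma descends_switch_fst a p T v : T \in SYT la [::] m -> p + a <= m -> v.+1 < a ->
  descends (switch a p T) (v + p) = descends T v.
Proof.
move=> hT + hv; elim: p => [|p IH] h /=; first by rewrite addn0.
rewrite addnS descends_slide ?IH //; try lia.
by apply: switch_SYT => //; lia.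
Qed.

Lemma descends_switch_far a p T v : p + a <= m -> p + a <= v ->
  descends (switch a p T) v = descends T v.
Proof.
elim: p => //= p IH h hv; rewrite descends_slide_far ?IH //; lia.
Qed.

Lemma descends_switch_snd a p T v : T \in SYT la [::] m -> p + a <= m -> v.+1 < p ->
  descends (switch a p T) v = descends T (v + a).
Proof.
move=> hT; elim: p => [|p IH] h hv //=.
(* The slides at offsets [v] and [v.+1] settle the pair [v, v.+1]; later slides touch larger entries
   only. *)
case: (ltnP v.+1 p) => hvp; first by rewrite descends_slide_far ?IH //; lia.
have -> : p = v.+1 by lia.
have hs : switch a v T \in SYT la [::] m by apply: switch_SYT => //; lia.
by rewrite descends_slide2 ?descends_switch_far //; lia.
Qed.

End StraightTableaux.

(** * Standardization and the expansion of Schur functions into fundamental ones *)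

Definition compatible (N k : nat) (D : {set 'I_k}) (g : {ffun 'I_k -> 'I_N}) :=
  [forall j : 'I_k, forall j' : 'I_k,
     (j.+1 == j' :> nat) ==> ((g j <= g j') && ((j \in D) ==> (g j < g j')))].

Lemma compatible_mono (N k : nat) (D : {set 'I_k}) (g : {ffun 'I_k -> 'I_N}) (i j : 'I_k) :
  compatible D g -> i <= j -> g i <= g j.
Proof.
move=> hg; move: {2}(j - i) (erefl (j - i)) => d; elim: d j => [|d IH] j hd hij.
  by have -> : i = j by apply: val_inj => /=; lia.
have hj : j.-1 < k by have := ltn_ord j; lia.
apply: leq_trans (IH (Ordinal hj) _ _) _ => /=; try lia.
have /forallP/(_ (Ordinal hj))/forallP/(_ j)/implyP := hg.
by rewrite /= prednK ?eqxx; [case/(_ isT)/andP|lia].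
Qed.

Section Standardization.

Variables (la : seq nat) (m0 N : nat).
Local Notation m := m0.+1.
Local Notation cell := (cellT la [::]).
Local Notation tableau := (tab la [::] m).
Implicit Types (x y z : cell) (T : tableau) (f : {ffun cell -> 'I_N})
  (g : {ffun 'I_m -> 'I_N}).

Definition semistandard f :=
  [forall x, forall y,
     ((row x == row y) && (col x < col y) ==> (f x <= f y))
     && ((col x == col y) && (row x < row y) ==> (f x < f y))].

Lemma semistandard_row f x y : semistandard f -> row x = row y -> col x < col y -> f x <= f y.
Proof.
by move=> /forallP/(_ x)/forallP/(_ y)/andP[/implyP + _] hr hc; rewrite hr hc eqxx => ->.
Qed.

Lemma semistandard_col f x y : semistandard f -> col x = col y -> row x < row y -> f x < f y.
Proof.
by move=> /forallP/(_ x)/forallP/(_ y)/andP[_ /implyP +] hr hc; rewrite hr hc eqxx => ->.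
Qed.

(** The standardization order: by value, and from left to right among equal values. It is total on a
    semistandard filling because columns are strict. *)
Definition before f x y := (f x < f y) || (f x == f y :> nat) && (col x < col y).

Lemma before_irr f x : before f x x = false.
Proof. by rewrite /before !ltnn andbF. Qed.

Lemma before_trans f x y z : before f x y -> before f y z -> before f x z.
Proof. by rewrite /before; lia. Qed.

Hypothesis la_part : is_part la.
Hypothesis la_sum : sumn la = m.

Lemma card_cell : #|{: cell}| = m.
Proof.
rewrite card_sig -la_sum sumnE (big_nth 0) big_mkord.
rewrite -sum1_card big_mkcond /=.
rewrite -(pair_bigA _ (fun (i : 'I_(size la)) (j : 'I_(nth 0 la 0)) =>
  if inskew la [::] i j then 1 else 0)) /=.
apply: eq_bigr => i _; rewrite -big_mkcond /= /inskew nth_nil /=.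
rewrite -(big_ord_widen _ (fun=> 1)) ?sum_nat_const ?card_ord ?muln1 //.
exact: part_nonincreasing.
Qed.

Lemma semistandard_lt f x y : semistandard f -> row x < row y -> col x <= col y -> f x < f y.
Proof.
move=> hf hr hc; have [z zr zc] := cell_below la_part (leqnn (row y)) hc.
have h1 : f x < f z by apply: semistandard_col; rewrite ?zr ?zc.
case: (ltngtP (col x) (col y)) hc => // [hlt|he] _.
  by apply: leq_trans h1 _; apply: semistandard_row; rewrite ?zr ?zc.
by have <- : z = y by apply: cell_inj; rewrite ?zr ?zc.
Qed.

Lemma before_total f x y : semistandard f -> x != y -> before f x y || before f y x.
Proof.
move=> hf; apply: contraNT; rewrite /before => h.
have ef : f x = f y :> nat by lia.
have ec : col x = col y by lia.
apply/eqP/cell_inj => //; case: (ltngtP (row x) (row y)) => // hr.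
  by have := semistandard_col hf ec hr; rewrite ef ltnn.
by have := semistandard_col hf (esym ec) hr; rewrite ef ltnn.
Qed.

(** A cell does not precede itself, so the count is below [m] and [inord] keeps its value. *)
Definition standardize f : tableau := [ffun x => inord #|[set y | before f y x]|].

Lemma standardizeE f x : standardize f x = #|[set y | before f y x]| :> nat.
Proof.
rewrite ffunE inordK // -[X in _ < X]card_cell -cardsT; apply: proper_card.
by apply/properP; split; [exact: subsetT|exists x => //; rewrite inE before_irr].
Qed.

Lemma standardize_lt f x y : before f x y -> standardize f x < standardize f y.
Proof.
move=> h; rewrite !standardizeE; apply: proper_card; apply/properP; split.
  by apply/subsetP=> z; rewrite !inE => hz; apply: before_trans h.
by exists x; rewrite inE ?before_irr.
Qed.

Lemma standardize_inj f : semistandard f -> injective (standardize f).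
Proof.
move=> hf x y e; apply/eqP; apply: contraT => /(before_total hf)/orP[]/standardize_lt;
  by rewrite e ltnn.
Qed.

Lemma before_standardize f x y : semistandard f ->
  standardize f x < standardize f y -> before f x y.
Proof.
move=> hf hlt; case: (eqVneq x y) => [e|/(before_total hf)/orP[]//]; first by rewrite e ltnn in hlt.
by move/standardize_lt; rewrite ltnNge ltnW.
Qed.

Lemma standardize_SYT f : semistandard f -> standardize f \in SYT la [::] m.
Proof.
move=> hf; have inj := standardize_inj hf; rewrite inE; apply/and3P; split.
- exact/injectiveP.
- apply/forallP=> k; have /mapP[x _ ->] : k \in codom (standardize f).
    by apply: inj_card_onto => //; rewrite card_cell card_ord.
  by apply/existsP; exists x.
apply/forallP=> x; apply/forallP=> y; apply/andP; split; apply/implyP=> /andP[/eqP h1 h2];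
  apply: standardize_lt; rewrite /before.
- by have := semistandard_row hf h1 h2; lia.
- by rewrite (semistandard_col hf h1 h2).
Qed.

(** If [g] takes the same value at both ends, it is constant in between, so no entry from [T x] up
    to [T y] is a descent and the rows never go down. *)
Lemma compatible_row T g x y : T \in SYT la [::] m -> compatible (DesT T) g ->
  T x <= T y -> g (T x) = g (T y) -> row y <= row x.
Proof.
move=> hT hg; move: {2}(T y - T x) (erefl (T y - T x)) => d.
elim: d y => [|d IH] y hd hxy he.
  have -> : x = y by apply/(SYT_inj hT)/ord_inj; lia.
  by [].
have [|z hz] := @SYT_surj _ _ _ T (T y).-1 hT; first by have := ltn_ord (T y); lia.
have h1 : T x <= T z by lia.
have h2 : T z <= T y by lia.
have g1 := compatible_mono hg h1; have g2 := compatible_mono hg h2.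
have ez : g (T x) = g (T z) by apply: ord_inj; rewrite -he in g2; lia.
apply: leq_trans (IH z _ h1 ez); last by lia.
have /forallP/(_ (T z))/forallP/(_ (T y))/implyP := hg.
have hzy : T y = (T z).+1 :> nat by lia.
rewrite hzy eqxx => /(_ isT)/andP[_]; rewrite -he ez ltnn implybF mem_DesT.
by rewrite /descends (at_consecE _ (SYT_inj hT) erefl hzy) -leqNgt.
Qed.

Definition pullback T g : {ffun cell -> 'I_N} := [ffun x => g (T x)].

(** When the values agree, [y] lies weakly above [x]; were it also weakly left, [T y <= T x] would
    follow. *)
Lemma before_pullback T g x y : T \in SYT la [::] m -> compatible (DesT T) g ->
  T x < T y -> before (pullback T g) x y.
Proof.
move=> hT hg hlt; rewrite /before !ffunE.
have := compatible_mono hg (ltnW hlt); rewrite leq_eqVlt => /orP[/eqP/val_inj e|->] //.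
rewrite e eqxx ltnn /= ltnNge; apply/negP=> hc.
have hr := compatible_row hT hg (ltnW hlt) e.
by have := SYT_mono la_part hT hr hc; rewrite leqNgt hlt.
Qed.

Lemma semistandard_pullback T g : T \in SYT la [::] m -> compatible (DesT T) g ->
  semistandard (pullback T g).
Proof.
move=> hT hg; apply/forallP=> x; apply/forallP=> y.
apply/andP; split; apply/implyP=> /andP[/eqP h1 h2]; rewrite !ffunE.
  by apply: compatible_mono hg _; apply/ltnW/SYT_row.
have hlt := SYT_col hT h1 h2.
have := compatible_mono hg (ltnW hlt); rewrite leq_eqVlt => /orP[/eqP/val_inj e|->] //.
by have := compatible_row hT hg (ltnW hlt) e; rewrite leqNgt h2.
Qed.

Lemma SYT_bij T : T \in SYT la [::] m -> bijective T.
Proof. by move=> /SYT_inj h; apply: inj_card_bij; rewrite // card_cell card_ord. Qed.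

Lemma standardize_pullback T g : T \in SYT la [::] m -> compatible (DesT T) g ->
  standardize (pullback T g) = T.
Proof.
move=> hT hg; apply/ffunP=> x; apply: val_inj; rewrite /= standardizeE.
have -> : [set y | before (pullback T g) y x] = T @^-1: [set k : 'I_m | k < T x].
  apply/setP=> y; rewrite !inE; apply/idP/idP; last exact: before_pullback.
  apply: contraLR; rewrite -leqNgt leq_eqVlt => /orP[/eqP e|/(before_pullback hT hg) h].
    have -> : x = y by apply/(SYT_inj hT)/val_inj.
    by rewrite before_irr.
  by apply/negP=> h'; have := before_trans h h'; rewrite before_irr.
rewrite on_card_preimset; last exact/onW_bij/SYT_bij.
rewrite -sum1_card (eq_bigl (fun k : 'I_m => k < T x)); last by move=> k; rewrite inE.
by rewrite -(big_ord_widen _ (fun=> 1)) ?sum_nat_const ?card_ord ?muln1 // ltnW.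
Qed.

Lemma compatible_standardize T g : T \in SYT la [::] m -> semistandard (pullback T g) ->
  standardize (pullback T g) = T -> compatible (DesT T) g.
Proof.
move=> hT hf hs; apply/forallP=> j; apply/forallP=> j'; apply/implyP=> /eqP e.
have [x hx] := SYT_surj hT (ltn_ord j); have [y hy] := SYT_surj hT (ltn_ord j').
have ex : T x = j by apply: val_inj.
have ey : T y = j' by apply: val_inj.
have : before (pullback T g) x y.
  by apply: before_standardize => //; rewrite hs hx hy -e.
rewrite /before !ffunE ex ey => hb; apply/andP; split; first by lia.
apply/implyP; rewrite mem_DesT /descends.
rewrite (at_consecE _ (SYT_inj hT) hx (_ : T y = j.+1 :> nat)); last by lia.
(* With equal values [y] would be to the right of [x] and strictly lower, which forces a strict
   increase. *)
move=> hr; have := semistandard_lt hf hr; rewrite !ffunE ex ey; lia.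
Qed.

Local Open Scope ring_scope.

(** Semistandard fillings are grouped by their standardization [T]; those in the group of [T] are
    the composites of [T] with the words compatible with [DesT T]. *)
Lemma schur_fundQ : schur N la = \sum_(T in SYT la [::] m) fundQ N (DesT T).
Proof.
rewrite /schur -/semistandard (partition_big standardize (mem (SYT la [::] m))); last first.
  by move=> f; apply: standardize_SYT.
apply: eq_bigr => T hT; have [T' TK T'K] := SYT_bij hT.
rewrite (reindex (pullback T)); last first.
  exists (fun f : {ffun cell -> 'I_N} => [ffun k => f (T' k)]) => f _;
    by apply/ffunP=> k; rewrite !ffunE ?TK ?T'K.
apply: eq_big => [g|g _].
  apply/andP/idP => [[h /eqP]|h]; first exact: compatible_standardize.
  split; first exact: semistandard_pullback.
  by rewrite standardize_pullback.
rewrite [RHS](reindex T) /=; last by exists T' => x _.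
by apply: eq_bigr => x _; rewrite ffunE.
Qed.

End Standardization.

(** * Linear independence of the fundamental quasisymmetric functions *)

Section FundamentalBasis.

Variable m0 : nat.
Local Notation m := m0.+1.
Implicit Types (D E : {set 'I_m}) (g h : {ffun 'I_m -> 'I_m}).

Definition weight g : 'X_{1..m} := (\sum_(j < m) U_(g j))%MM.

Lemma weightE g i : weight g i = count_mem i (codom g).
Proof.
rewrite /weight mnm_sumE codomE count_map -sum1_count [RHS]big_mkcond big_enum /=.
by apply: eq_bigr => j _; rewrite mnm1E; case: (g j == i).
Qed.

Lemma weakly_increasing_codom D g : compatible D g -> sorted leq [seq val i | i <- codom g].
Proof.
move=> hg; rewrite codomE -map_comp.
apply: (@homo_sorted _ _ _ (relpre val leq)); first by move=> i j /(compatible_mono hg).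
by rewrite -sorted_map val_enum_ord iota_sorted.
Qed.

(** A weakly increasing word is the sorted list of its letters, and the weight records their
    multiplicities. *)
Lemma weight_inj D D' g h : compatible D g -> compatible D' h -> weight g = weight h -> g = h.
Proof.
move=> hg hh e.
have hp : perm_eq (codom g) (codom h).
  by apply/allP=> i _; rewrite /= -!weightE e.
have hs : [seq val i | i <- codom g] = [seq val i | i <- codom h].
  apply: (sorted_eq leq_trans anti_leq); last exact: perm_map.
  - exact: weakly_increasing_codom hg.
  - exact: weakly_increasing_codom hh.
have hc := inj_map val_inj hs; apply/ffunP=> i; rewrite !codomE in hc.
by move/eq_in_map: hc => hc; apply: hc; rewrite mem_enum.
Qed.

(** The weakly increasing word starting at 0 that rises by one just after each position in [E]. Its
    monomial tests which [D] are contained in [E], and [m] letters suffice for it. *)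
Definition jumps E : {ffun 'I_m -> 'I_m} :=
  [ffun j : 'I_m => inord #|[set e in E | e < j]|].

Lemma card_ord_lt k : k <= m -> #|[set e : 'I_m | e < k]| = k.
Proof.
move=> hk; rewrite -sum1_card (eq_bigl (fun e : 'I_m => e < k)); last by move=> e; rewrite inE.
by rewrite -(big_ord_widen _ (fun=> 1)) ?sum_nat_const ?card_ord ?muln1.
Qed.

Lemma jumpsE E (j : 'I_m) : jumps E j = #|[set e in E | e < j]| :> nat.
Proof.
rewrite ffunE inordK //; apply: (@leq_ltn_trans j); last exact: ltn_ord.
rewrite -[X in _ <= X](card_ord_lt (ltnW (ltn_ord j))); apply: subset_leq_card.
by apply/subsetP=> e; rewrite !inE => /andP[].
Qed.

Lemma jumpsS E (j j' : 'I_m) : j.+1 = j' :> nat -> jumps E j' = jumps E j + (j \in E) :> nat.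
Proof.
move=> e; rewrite !jumpsE (cardsD1 j [set i in E | i < j']) addnC.
have -> : (j \in [set i in E | i < j']) = (j \in E) by rewrite inE -e leqnn andbT.
congr (_ + _).
by apply: eq_card => i; rewrite !inE -(inj_eq val_inj) /= -e; case: (i \in E); lia.
Qed.

Lemma jumps_compatible D E : D \subset E -> compatible D (jumps E).
Proof.
move/subsetP=> hs; apply/forallP=> j; apply/forallP=> j'; apply/implyP=> /eqP e.
rewrite (jumpsS E e) leq_addr; apply/implyP=> /hs ->.
by rewrite addn1.
Qed.

Lemma compatible_jumps D E : D \subset [set k : 'I_m | k.+1 < m] ->
  compatible D (jumps E) = (D \subset E).
Proof.
move=> hD; apply/idP/idP => [/forallP hc|]; last exact: jumps_compatible.
apply/subsetP=> j hj.
have := subsetP hD j hj; rewrite inE => hlt.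
have /forallP/(_ (Ordinal hlt))/implyP/(_ (eqxx _))/andP[_ /implyP/(_ hj)] := hc j.
by rewrite (@jumpsS E j (Ordinal hlt)) // -ltn_subLR // subnn lt0b.
Qed.

Local Open Scope ring_scope.

Lemma fundQE (N : nat) D : fundQ N D = \sum_(g | compatible D g) 'X_[\sum_(j < m) U_(g j)].
Proof.
apply: eq_bigr => g _.
by rewrite (big_morph _ (@mpolyXD _ _) (@mpolyX0 _ _)).
Qed.

Lemma mcoeff_fundQ D E : D \subset [set k : 'I_m | k.+1 < m]%N ->
  (fundQ m D)@_(weight (jumps E)) = (D \subset E)%:R.
Proof.
move=> hD; have hE := jumps_compatible (subxx E).
rewrite fundQE raddf_sum /= -(compatible_jumps E hD); case: (boolP (compatible D (jumps E))) => h /=.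
  rewrite (bigD1 (jumps E)) //= mcoeffX eqxx big1 ?addr0 // => g /andP[hg /eqP hn].
  by rewrite mcoeffX; case: eqP => // e; case: hn; apply: weight_inj hg hE e.
rewrite big1 // => g hg; rewrite mcoeffX; case: eqP => // e.
by rewrite -(weight_inj hg hE e) hg in h.
Qed.

(** The coefficient at the weight of [jumps E] counts the members contained in [E]. These counts
    determine the multiplicity of each set by induction on its size. *)
Lemma fundQ_free (s t : seq {set 'I_m}) :
  (forall D, D \in s ++ t -> D \subset [set k : 'I_m | k.+1 < m]%N) ->
  \sum_(D <- s) fundQ m D = \sum_(D <- t) fundQ m D -> perm_eq s t.
Proof.
move=> hst e.
have mc (r : seq {set 'I_m}) E : {subset r <= s ++ t} ->
    (\sum_(D <- r) fundQ m D)@_(weight (jumps E)) = (count (fun D => D \subset E) r)%:R.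
  move=> hr; rewrite raddf_sum /= -sum1_count natr_sum [RHS]big_mkcond /=.
  rewrite big_seq [RHS]big_seq; apply: eq_bigr => D /hr/hst hD.
  by rewrite mcoeff_fundQ //; case: (D \subset E).
have hc E : count (fun D => D \subset E) s = count (fun D => D \subset E) t.
  apply/eqP; rewrite -(eqr_nat int) -!mc ?e // => D hD; by rewrite mem_cat hD ?orbT.
have split_count (r : seq {set 'I_m}) E : count (fun D => D \subset E) r =
    (count_mem E r + \sum_(D : {set 'I_m} | D \proper E) count_mem D r)%N.
  elim: r => [|F r IH] /=; first by rewrite big1.
  rewrite IH big_split /= addnACA; congr (_ + _)%N.
  have [->|hn] := eqVneq F E.
    rewrite subxx big1 // => D hD; case: eqP => // hE; by rewrite hE properxx in hD.
  rewrite add0n; case: (boolP (F \proper E)) => hp.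
    rewrite (bigD1 F) //= eqxx big1 ?(proper_sub hp) // => D /andP[_].
    by rewrite eq_sym => /negPf ->.
  rewrite big1 => [|D hD]; last by case: eqP => // hF; rewrite hF hD in hp.
  by move: hp; rewrite properEneq hn /= => /negPf ->.
apply/allP=> E _ /=; apply/eqP; move: {2}#|E|.+1 (ltnSn #|E|) => k.
elim: k E => // k IH E hk; apply/eqP.
have := hc E; rewrite !split_count.
have -> : (\sum_(D : {set 'I_m} | D \proper E) count_mem D s =
  \sum_(D : {set 'I_m} | D \proper E) count_mem D t)%N.
  by apply: eq_bigr => D /proper_card hD; apply: IH; apply: leq_trans hD _.
by move/eqP; rewrite eqn_add2r.
Qed.

End FundamentalBasis.

(** * Rotations of subsets of [[n]] *)

Section CyclicRotation.

Variable m0 : nat.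
Local Notation m := m0.+1.
Local Notation n := m0.+2.
Implicit Types (D : {set 'I_m}) (B : {set 'I_n}) (k v : 'I_n).

Definition close_up D : {set 'I_n} := ord_max |: [set widen_ord (leqnSn m) d | d in D].

(** The translate of [B] by [ordS k] in the integers modulo [n]: the ordinal [k] encodes the number
    [k + 1], which is the amount of the shift. *)
Definition rotate k B : {set 'I_n} := [set v | (v - ordS k)%R \in B].

Lemma mem_rotate k B v : (v \in rotate k B) = ((v - ordS k)%R \in B).
Proof. exact: in_set. Qed.

Lemma val_sub_ordS v k :
  (v - ordS k)%R = (if k < v then v - k.+1 else v + m - k) :> nat.
Proof.
have hv := ltn_ord v; have hk := ltn_ord k => /=.
have [e|hlt] : k.+1 = n \/ k.+1 < n by lia.
  rewrite e modnn subn0 modnn addn0 modn_small //; case: ifP; lia.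
rewrite (modn_small hlt) (@modn_small (_ - _)); last lia.
case: ifP => h; last by rewrite modn_small; lia.
have -> : v + (n - k.+1) = (v - k.+1) + n by lia.
by rewrite modnDr modn_small; lia.
Qed.

Lemma ordS_add1 k : ordS k = (k + 1)%R.
Proof. exact: esym (@add_Zp_1 n k). Qed.

Lemma rotate_ordS k B : rotate (ordS k) B = [set ordS v | v in rotate k B].
Proof.
have shift u : (ordS u - ordS (ordS k) = u - ordS k)%R.
  by rewrite [ordS u]ordS_add1 [ordS (ordS k)]ordS_add1 opprD addrACA subrr addr0.
apply/setP=> v; apply/idP/imsetP => [|[u + ->]]; rewrite !mem_rotate ?shift // => h.
by exists (ord_pred v); rewrite ?ord_predK // mem_rotate -shift ord_predK.
Qed.

Lemma mem_close_up D v : (v \in close_up D) = (v == m :> nat) || [exists d in D, d == v :> nat].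
Proof.
rewrite in_setU1 -(inj_eq val_inj) /=; congr (_ || _).
apply/imsetP/existsP => [[d hd ->]|[d /andP[hd /eqP e]]].
  by exists d; rewrite hd eqxx.
by exists d => //; apply: val_inj; rewrite /= e.
Qed.

Lemma rotate_close_up_neq0 k D : rotate k (close_up D) != set0.
Proof.
apply/set0Pn; exists k; rewrite mem_rotate mem_close_up val_sub_ordS ltnn.
by rewrite addKn eqxx.
Qed.

Lemma rotate_close_up_neqT k D : D \subset [set d : 'I_m | d.+1 < m] ->
  rotate k (close_up D) != setT.
Proof.
(* The ordinal [m0] encodes [n - 1], which is missing from [close_up D]; its translate is missing
   from the rotation. *)
move=> hD; apply/negP=> /eqP/setP/(_ (inord m0 + ordS k)%R).
rewrite in_setT mem_rotate addrK mem_close_up inordK // ltn_eqF //=.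
apply/negP; rewrite negb_exists; apply/forallP=> d; apply/negP=> /andP[/(subsetP hD)].
by rewrite inE => h /eqP e; rewrite e ltnn in h.
Qed.

End CyclicRotation.

(** * The shape with a box attached to the north-east *)

Section ExtraBox.

Variables (a : nat) (l : seq nat) (m0 : nat).
Local Notation m := m0.+1.
Local Notation n := m0.+2.
Local Notation la := (a :: l).
Local Notation la' := (a.+1 :: la).
Local Notation mu' := [:: a].

Lemma lower_subproof (x : cellT la [::]) : inskew la' mu' (lift ord0 (val x).1) (val x).2.
Proof. by have := valP x; rewrite /inskew lift0 /= !nth_nil. Qed.

(** The shape [la' / mu'] consists of a copy of [la] moved one row down and of a single cell in the
    first row, at column [a]. *)
Definition lower (x : cellT la [::]) : cellT la' mu' :=
  @mk_cell la' mu' (lift ord0 (val x).1) (widen_ord (leqnSn a) (val x).2) (lower_subproof x).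

Lemma box_subproof : inskew la' mu' (@ord0 (size la)) (@ord_max a).
Proof. by rewrite /inskew /= leqnn ltnSn. Qed.

Definition box : cellT la' mu' := @mk_cell la' mu' ord0 (@ord_max a) box_subproof.

Lemma row_lower x : row (lower x) = (row x).+1. Proof. by []. Qed.
Lemma col_lower x : col (lower x) = col x. Proof. by []. Qed.
Lemma row_box : row box = 0. Proof. by []. Qed.
Lemma col_box : col box = a. Proof. by []. Qed.

Lemma lower_inj : injective lower.
Proof.
move=> x y e; apply: cell_inj; last by rewrite -!col_lower e.
by apply: succn_inj; rewrite -!row_lower e.
Qed.

Lemma col_lt (x : cellT la [::]) : col x < a.
Proof. exact: ltn_ord (val x).2. Qed.

Lemma lower_neq_box x : lower x != box.
Proof. by apply/eqP=> e; have := row_lower x; rewrite e row_box. Qed.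

Hypothesis la_part : is_part la.

Lemma cellP y : y = box \/ exists x, y = lower x.
Proof.
have := valP y; rewrite -[(val y).1 : nat]/(row y) -[(val y).2 : nat]/(col y) /inskew.
case hr : (row y) => [|r] /= hc.
  left; apply: cell_inj; rewrite ?row_box ?col_box ?hr //; lia.
move/andP: hc => [_ hc]; have [x xr xc] := cell_ex la_part hc.
by right; exists x; apply: cell_inj; rewrite ?row_lower ?col_lower ?xr ?xc.
Qed.

Implicit Types (T U : tab la [::] m) (k : 'I_n) (S : tab la' mu' n).

Definition insert_box U k : tab la' mu' n :=
  [ffun y => if [pick x | lower x == y] is Some x then lift k (U x) else k].

Lemma insert_lower U k x : insert_box U k (lower x) = lift k (U x).
Proof.
rewrite ffunE; case: pickP => [z /eqP/lower_inj -> //|/(_ x)].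
by rewrite eqxx.
Qed.

Lemma insert_at_box U k : insert_box U k box = k.
Proof. by rewrite ffunE; case: pickP => // z; rewrite (negPf (lower_neq_box z)). Qed.

Lemma lift_lt k (i j : 'I_m) : (lift k i < lift k j) = (i < j).
Proof. by rewrite /= /bump; lia. Qed.

Lemma insert_box_SYT U k : U \in SYT la [::] m -> insert_box U k \in SYT la' mu' n.
Proof.
move=> hU; rewrite inE; apply/and3P; split.
- apply/injectiveP=> y z.
  have [->|[x ->]] := cellP y; have [->|[x' ->]] := cellP z; rewrite ?insert_at_box ?insert_lower //.
  + by move/eqP; rewrite (negPf (neq_lift _ _)).
  + by move/esym/eqP; rewrite (negPf (neq_lift _ _)).
  + by move/lift_inj/(SYT_inj hU) ->.
- apply/forallP=> i; apply/existsP; case: (unliftP k i) => [j ->|->].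
    have [x hx] := SYT_surj hU (ltn_ord j).
    by exists (lower x); rewrite insert_lower; apply/eqP; congr lift; apply: val_inj.
  by exists box; rewrite insert_at_box.
apply/forallP=> y; apply/forallP=> z.
have [->|[x ->]] := cellP y; have [->|[x' ->]] := cellP z;
  rewrite ?ltnn ?andbF // ?row_box ?col_box ?row_lower ?col_lower //=.
- by rewrite (gtn_eqF (col_lt x')).
rewrite !insert_lower !lift_lt eqSS ltnS; apply/andP; split; apply/implyP=> /andP[/eqP h1 h2].
- exact: SYT_row.
- exact: SYT_col.
Qed.

Lemma insert_box_inj U U' k k' : insert_box U k = insert_box U' k' -> U = U' /\ k = k'.
Proof.
move=> e; have ek : k = k' by rewrite -(insert_at_box U k) e insert_at_box.
rewrite -ek in e *; split=> //; apply/ffunP=> x; apply: (@lift_inj _ k).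
by rewrite -!insert_lower e.
Qed.

Lemma insert_box_onto S : S \in SYT la' mu' n ->
  exists2 U, U \in SYT la [::] m & S = insert_box U (S box).
Proof.
move=> hS; have injS := SYT_inj hS.
have hl x : exists j, S (lower x) == lift (S box) j.
  case: (unliftP (S box) (S (lower x))) => [j ->|/injS/eqP]; first by exists j.
  by rewrite (negPf (lower_neq_box x)).
pose U : tab la [::] m := [ffun x => xchoose (hl x)].
have hU x : S (lower x) = lift (S box) (U x) by rewrite ffunE; apply/eqP/(xchooseP (hl x)).
exists U; last first.
  by apply/ffunP=> y; have [->|[x ->]] := cellP y; rewrite ?insert_at_box ?insert_lower.
rewrite inE; apply/and3P; split.
- by apply/injectiveP=> x y e; apply/lower_inj/injS; rewrite !hU e.
- apply/forallP=> j; have [y hy] := SYT_surj hS (ltn_ord (lift (S box) j)).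
  have {}hy : S y = lift (S box) j by apply: val_inj.
  have [ey|[x ey]] := cellP y; rewrite ey in hy.
    by have := neq_lift (S box) j; rewrite -hy eqxx.
  by apply/existsP; exists x; apply/eqP/(@lift_inj _ (S box)); rewrite -hU.
apply/forallP=> x; apply/forallP=> y; apply/andP; split; apply/implyP=> /andP[/eqP h1 h2];
  rewrite -(lift_lt (S box)) -!hU.
- by apply: SYT_row; rewrite ?row_lower ?h1.
- by apply: SYT_col; rewrite ?row_lower ?h1.
Qed.

(** The box lies above all other cells, so its entry [k] is a descent and [k - 1] is not; other
    pairs of consecutive entries come from [U], lowered by one beyond [k]. *)
Lemma descends_insert_box U k (v : nat) : U \in SYT la [::] m -> v < m ->
  descends (insert_box U k) v =
    if v < k then (v.+1 < k) && descends U v else (v == k) || descends U v.-1.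
Proof.
move=> hU hv; have hI := SYT_inj (insert_box_SYT k hU).
have hl (w : nat) x : U x = w :> nat -> insert_box U k (lower x) = bump k w :> nat.
  by move=> <-; rewrite insert_lower.
have hb : insert_box U k box = k :> nat by rewrite insert_at_box.
have hk := ltn_ord k.
have low (w : nat) : w.+1 < m -> v = bump k w -> v.+1 = bump k w.+1 ->
    descends (insert_box U k) v = descends U w.
  move=> hw e1 e2.
  have [x hx] := SYT_surj hU (ltnW hw); have [y hy] := SYT_surj hU hw.
  have := hl _ _ hx; have := hl _ _ hy; rewrite -e1 -e2 => hy' hx'.
  by rewrite /descends (at_consecE _ (SYT_inj hU) hx hy) (at_consecE _ hI hx' hy').
case: (ltngtP v k) => hvk /=.
- case: (ltnP v.+1 k) => h /=; first by apply: low; rewrite /bump; lia.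
  have [x hx] := SYT_surj hU hv.
  have e1 : insert_box U k (lower x) = v :> nat by rewrite (hl _ _ hx) /bump; lia.
  have e2 : insert_box U k box = v.+1 :> nat by rewrite hb; lia.
  by rewrite /descends (at_consecE _ hI e1 e2).
- by apply: low; rewrite /bump; lia.
- have [x hx] := SYT_surj hU hv.
  have e1 : insert_box U k box = v :> nat by rewrite hb hvk.
  have e2 : insert_box U k (lower x) = v.+1 :> nat by rewrite (hl _ _ hx) /bump; lia.
  by rewrite /descends (at_consecE _ hI e1 e2).
Qed.

Definition rotated T k : tab la' mu' n := insert_box (switch (m - k) k T) k.

(** Below [k] stand the last [k] entries of [T], above it the first [m - k], with the descents
    inside both blocks kept. The descent made by the box is the image of the added element
    [ord_max]. *)
Lemma DesT_rotated T k : T \in SYT la [::] m ->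
  rotate k (close_up (DesT T)) :&: [set v : 'I_n | v.+1 < n] = DesT (rotated T k).
Proof.
move=> hT; have hk := ltn_ord k; have hsw : k + (m - k) <= m by lia.
have hU := switch_SYT la_part hsw hT.
have mem_des (w : nat) : [exists d in DesT T, d == w :> nat] = descends T w.
  apply/existsP/idP => [[d /andP[hd /eqP <-]]|hd]; first by rewrite -mem_DesT.
  have hw : w < m.
    by rewrite ltnNge; apply/negP=> hw; rewrite /descends at_consec_ge ?leqW in hd.
  by exists (Ordinal hw); rewrite mem_DesT hd eqxx.
apply/setP=> v; rewrite mem_DesT in_setI mem_rotate mem_close_up in_set val_sub_ordS mem_des ltnS.
case: (ltnP v m) => hv; last first.
  by rewrite andbF /descends at_consec_ge.
rewrite andbT descends_insert_box //.
case: (ltngtP v k) => hvk /=.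
- have -> : (v + m - k == m) = false by lia.
  case: (ltnP v.+1 k) => h /=.
    by rewrite descends_switch_snd // -addnBA //; lia.
  (* For [v.+1 = k] the index is [m - 1], the largest entry of [T], which is never a descent. *)
  by rewrite /descends at_consec_ge //; lia.
- have -> : (v - k.+1 == m) = false by lia.
  have -> : v.-1 = (v - k.+1) + k by lia.
  by rewrite descends_switch_fst //; lia.
- by rewrite hvk addKn eqxx.
Qed.

Lemma rotated_SYT T k : T \in SYT la [::] m -> rotated T k \in SYT la' mu' n.
Proof.
move=> hT; have hk := ltn_ord k.
by apply: insert_box_SYT; apply: switch_SYT => //; lia.
Qed.

Lemma rotated_inj T T' k k' : rotated T k = rotated T' k' -> T = T' /\ k = k'.
Proof.
case/insert_box_inj=> + ek; rewrite -ek => e; split=> //.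
by apply: switch_inj e; have := ltn_ord k; lia.
Qed.

(** Switching is an injective map of the finite set of standard tableaux to itself, hence onto. *)
Lemma rotated_onto S : S \in SYT la' mu' n ->
  exists2 T, T \in SYT la [::] m & exists k, S = rotated T k.
Proof.
case/insert_box_onto=> U hU ->; move: (S box) => k.
have hk : k + (m - k) <= m by have := ltn_ord k; lia.
have : U \in [set switch (m - k) k T | T in SYT la [::] m].
  suff -> : [set switch (m - k) k T | T in SYT la [::] m] = SYT la [::] m by [].
  apply/eqP; rewrite eqEcard card_imset ?leqnn ?andbT; last exact: switch_inj hk.
  by apply/subsetP=> _ /imsetP[T hT ->]; apply: switch_SYT.
by case/imsetP=> T hT ->; exists T => //; exists k.
Qed.

Local Open Scope ring_scope.

Definition rotated_gf : {mpoly int[n]} :=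
  \sum_(T in SYT la [::] m) \sum_k xmon (rotate k (close_up (DesT T))).

Lemma cdes_gf_extra_box : cdes_gf la' mu' rotated_gf.
Proof.
pose inv S := [pick p : tab la [::] m * 'I_n |
  (p.1 \in SYT la [::] m) && (rotated p.1 p.2 == S)].
have invE T k : T \in SYT la [::] m -> inv (rotated T k) = Some (T, k).
  move=> hT; rewrite /inv; case: pickP => [[T' k'] /= /andP[_ /eqP/rotated_inj[-> ->]] //|].
  by move/(_ (T, k)); rewrite /= hT eqxx.
(* The default values concern only fillings that are not standard. The bijection [psi] keeps [T] and
   advances [k] cyclically. *)
pose cD S := if inv S is Some (T, k) then rotate k (close_up (DesT T)) else set0.
pose psi S := if inv S is Some (T, k) then rotated T (ordS k) else S.
have cDE T k : T \in SYT la [::] m -> cD (rotated T k) = rotate k (close_up (DesT T)).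
  by move=> hT; rewrite /cD invE.
have psiE T k : T \in SYT la [::] m -> psi (rotated T k) = rotated T (ordS k).
  by move=> hT; rewrite /psi invE.
exists cD, psi; split; first split.
- by move=> S /rotated_onto[T hT [k ->]]; rewrite psiE ?rotated_SYT.
- move=> S S' /rotated_onto[T hT [k ->]] /rotated_onto[T' hT' [k' ->]].
  by rewrite !psiE // => /rotated_inj[-> /ordS_inj ->].
- by move=> S /rotated_onto[T hT [k ->]]; rewrite cDE ?DesT_rotated.
- by move=> S /rotated_onto[T hT [k ->]]; rewrite psiE // !cDE // rotate_ordS.
- move=> S /rotated_onto[T hT [k ->]]; rewrite cDE //.
  by split; [exact: rotate_close_up_neq0|apply: rotate_close_up_neqT; exact: DesT_sub].
have -> : SYT la' mu' n =
    [set rotated p.1 p.2 | p in setX (SYT la [::] m) [set: 'I_n]].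
  apply/setP=> S; apply/idP/imsetP => [/rotated_onto[T hT [k ->]]|[[T k]]].
    by exists (T, k); rewrite // !inE in hT *; rewrite hT.
  by rewrite in_setX => /andP[hT _] ->; apply: rotated_SYT.
rewrite big_imset /=; last by move=> [T k] [T' k'] _ _ /rotated_inj[/= -> ->].
rewrite /rotated_gf pair_big_dep /=; apply: eq_big => [[T k]|[T k] /andP[hT _]] /=.
  by rewrite in_setX in_setT.
by rewrite cDE.
Qed.

Local Close Scope ring_scope.

(** Connectedness fails: the box shares neither a row nor a column with any other cell, so no path
    leaves it. *)
Lemma not_ribbon_extra_box : ~~ connected_ribbon la' mu'.
Proof.
rewrite negb_and; apply/orP; left.
have [x _ _] : exists2 x : cellT la [::], row x = 0 & col x = 0.
  by apply: cell_ex => //=; case/andP: la_part => _ /= /andP[].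
apply/negP=> /forallP/(_ box)/forallP/(_ (lower x))/connectP[[|y p] /=].
  by move=> _ e; have := lower_neq_box x; rewrite e eqxx.
case/andP=> + _ _; have [->|[z ->]] := cellP y.
  by rewrite /adj row_box col_box; lia.
by rewrite /adj row_box col_box row_lower col_lower; have := col_lt z; lia.
Qed.

Hypothesis la_sum : sumn la = m.

Lemma skew_shape_extra_box : skew_shape la' mu' n.
Proof.
case/andP: (la_part) => hs /= /andP[ha hl]; apply/and5P; split => //=.
- by rewrite /is_part /= leqnSn ha hl !andbT; exact: hs.
- by rewrite /is_part /= ha.
- by apply/forallP=> -[[|i] hi] //=; rewrite leqnSn.
- by move: la_sum => /=; lia.
Qed.

End ExtraBox.

(** * Cyclic descents of the elements of [A C_n] *)

Section RotatedPermutations.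

Variable m0 : nat.
Local Notation m := m0.+1.
Local Notation n := m0.+2.
Implicit Types (s : 'S_m) (k v : 'I_n).

Lemma cycX k v : (cyc n ^+ k)%g v = (v + k)%R.
Proof.
have iterE i : iter i (cyc n) v = (v + i%:R)%R.
  elim: i => [|i IH]; first by rewrite addr0.
  by rewrite iterS IH permE ordS_add1 -addrA natr1.
have e : (k%:R)%R = k := natr_Zp k.
by rewrite permX iterE e.
Qed.

Lemma embed_max s : embed s ord_max = ord_max.
Proof. exact: lift_perm_id. Qed.

Lemma embed_lift s j : embed s (lift ord_max j) = lift ord_max (s j).
Proof. exact: lift_perm_lift. Qed.

(** The largest value stands last, so it makes an ascent at position [n - 1] and a cyclic descent at
    position [n]. *)
Lemma cDes_embed s : cDes (embed s) = close_up (Des s).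
Proof.
apply/setP=> v; rewrite in_set mem_close_up.
case: (unliftP ord_max v) => [j ->|->].
  rewrite embed_lift (lift_max j) ltn_eqF ?ltn_ord // orFb.
  have -> : [exists d in Des s, d == j :> nat] = (j \in Des s).
    apply/existsP/idP => [[d /andP[hd /eqP/val_inj <-]] //|hj].
    by exists j; rewrite hj eqxx.
  rewrite in_set; case: (ltnP j.+1 m) => hj; rewrite ?andTb ?andFb.
    have -> : ordS (lift ord_max j) = lift ord_max (ordS j).
      by apply: ord_inj; rewrite !lift_max /= -[bump _ _]/(nat_of_ord (lift ord_max j)) lift_max !modn_small // ltnW.
    by rewrite embed_lift !lift_max.
  have -> : ordS (lift ord_max j) = ord_max.
    have ej : j.+1 = m by have := ltn_ord j; lia.
    by apply: ord_inj; rewrite [LHS]/= -[bump _ _]/(nat_of_ord (lift ord_max j)) lift_max ej modn_small.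
  by rewrite embed_max ltnNge ltnW // lift_max.
rewrite embed_max eqxx orTb.
have -> : ordS ord_max = lift ord_max ord0 :> 'I_n by apply: ord_inj; rewrite lift_max /= modnn.
by rewrite embed_lift lift_max ltn_ord.
Qed.

Lemma cDes_cycX_embed s k : cDes (cyc n ^+ k * embed s)%g = [set v | (v + k)%R \in close_up (Des s)].
Proof.
rewrite -cDes_embed; apply/setP=> v; rewrite !in_set !permM !cycX.
by rewrite !ordS_add1 addrAC.
Qed.

Lemma cycX_embed_inj k k' s s' :
  (cyc n ^+ k * embed s = cyc n ^+ k' * embed s')%g -> k = k' /\ s = s'.
Proof.
move=> e; have ek : k = k'.
  (* The exponent is read off from the position of the largest value, which is [ord_max - k]. *)
  have := congr1 (fun p : 'S_n => p (ord_max - k)%R) e.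
  rewrite /= !permM !cycX subrK embed_max -[in LHS](embed_max s') => /perm_inj.
  by rewrite -addrA -[LHS]addr0 => /addrI/esym/eqP; rewrite addrC subr_eq0 => /eqP.
split=> //; move: e; rewrite ek => /mulgI e; apply/permP=> j.
by apply: (@lift_inj _ ord_max); rewrite -!embed_lift e.
Qed.

Local Open Scope ring_scope.

Lemma sum_ACn (A : {set 'S_m}) :
  \sum_(p in ACn A) xmon (cDes p) =
  \sum_(s in A) \sum_k xmon (rotate k (close_up (Des s))).
Proof.
have -> : ACn A = [set (cyc n ^+ p.2 * embed p.1)%g | p : 'S_m * 'I_n in setX A setT].
  apply/setP=> p; apply/imset2P/imsetP => [[c s /imsetP[k _ ->] hs ->]|[[s k] /=]].
    by exists (s, k); rewrite // in_setX hs in_setT.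
  rewrite in_setX => /andP[hs _] ->; exists (cyc n ^+ k)%g s => //.
  exact: imset_f.
rewrite big_imset /=; last by move=> [s k] [s' k'] _ _ /cycX_embed_inj[/= -> ->].
rewrite (eq_bigl (fun p : 'S_m * 'I_n => (p.1 \in A) && true)); last first.
  by move=> [s k]; rewrite in_setX in_setT.
rewrite -(pair_big_dep (mem A) (fun _ _ => true)
  (fun s k => xmon (cDes (cyc n ^+ k * embed s)%g))) /=.
(* The power [k] rotates the cyclic descent set by [- k]; this substitution turns it into the
   rotation by [ordS k]. *)
apply: eq_bigr => s _; rewrite (reindex_inj (h := fun k : 'I_n => - ordS k)); last first.
  by move=> k k' /oppr_inj/ordS_inj.
apply: eq_bigr => k _; congr xmon; rewrite cDes_cycX_embed.
by apply/setP=> v; rewrite mem_rotate in_set.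
Qed.

End RotatedPermutations.

(** * Transfer of the descent distribution and conclusion *)

Local Open Scope ring_scope.

(** By linear independence in [m0.+1] variables, the descent sets of [A] and those of the tableaux
    form the same multiset, so any function [h] has the same sum over both. *)
Lemma SchurPos_Des_sum (m0 : nat) (A : {set 'S_m0.+1}) (ps : seq (seq nat))
    (V : nmodType) (h : {set 'I_m0.+1} -> V) :
  (forall la, la \in ps -> is_part la && (sumn la == m0.+1)) ->
  (forall N : nat, \sum_(s in A) fundQ N (Des s) = \sum_(la <- ps) schur N la) ->
  \sum_(s in A) h (Des s) = \sum_(la <- ps) \sum_(T in SYT la [::] m0.+1) h (DesT T).
Proof.
move=> hps hA.
pose l1 := [seq Des s | s <- enum A].
pose l2 := flatten [seq [seq DesT T | T <- enum (SYT la [::] m0.+1)] | la <- ps].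
have sum1 (W : nmodType) (F : {set 'I_m0.+1} -> W) : \sum_(D <- l1) F D = \sum_(s in A) F (Des s).
  by rewrite big_map big_enum.
have sum2 (W : nmodType) (F : {set 'I_m0.+1} -> W) :
    \sum_(D <- l2) F D = \sum_(la <- ps) \sum_(T in SYT la [::] m0.+1) F (DesT T).
  by rewrite big_flatten /= big_map; apply: eq_bigr => la _; rewrite big_map big_enum.
rewrite -sum1 -sum2; apply: perm_big; apply: fundQ_free.
  move=> D; rewrite mem_cat => /orP[/mapP[s _ ->]|/flattenP[t /mapP[la _ ->] /mapP[T _ ->]]].
    by apply/subsetP=> d; rewrite !inE => /andP[].
  exact: DesT_sub.
rewrite sum1 sum2 hA big_seq [RHS]big_seq; apply: eq_bigr => la /hps/andP[hp /eqP hs].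
exact: schur_fundQ.
Qed.

(* n = m.+1 >= 2; A is a subset of S_{n-1} = S_m *)
Theorem theorem3p11 (m : nat) (A : {set 'S_m}) :
  (1 <= m)%N -> SchurPos A -> cSp (ACn A).
Proof.
case: m A => // m0 A _ [ps [hps hA]].
(* Each partition of the Schur expansion gives the shape with the box attached; it is nonempty since
   its size is [m0.+1], so [head] and [behead] recover it. *)
exists [seq (((head 0%N la).+1 :: la, [:: head 0%N la]), rotated_gf (head 0%N la) (behead la) m0)
       | la <- ps].
split.
  move=> _ /mapP[la /hps + ->] /=; case: la => [|a l] // /andP[hp /eqP hs].
  split; [exact: skew_shape_extra_box|exact: not_ribbon_extra_box|exact: cdes_gf_extra_box].
rewrite sum_ACn.
(* The function of the descent set to transfer is the sum over all rotations of its closure. *)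
rewrite (SchurPos_Des_sum (fun D => \sum_k xmon (rotate k (close_up D))) hps hA).
rewrite big_map big_seq [RHS]big_seq.
by apply: eq_bigr => la /hps; case: la.
Qed.
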